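(* Let $X=\langle X,\tau,\le,X_0\rangle$ be a generalized Priestley space and define $\psi:X\to(X^* )_*$ by $\psi(x)=\{U\in X^*:x\in U\}$. Then $\psi$ is a well-defined map which is an order-isomorphism and a homeomorphism from $\langle X,\tau,\le\rangle$ onto $\langle (X^* )_*,\tau,\subseteq\rangle$, and $\psi[X_0]=(X^* )_+$.
   Context: A Priestley space is a compact space with a partial order $\le$ such that if $x\not\le y$ there is a clopen upset containing $x$ and not $y$. For $X=\langle X,\tau,\le,X_0\rangle$ with $\langle X,\tau,\le\rangle$ a Priestley space and $X_0\subseteq X$, $X^*$ is the set of clopen upsets $U$ with $\mathrm{max}(X-U)\subseteq X_0$, and $\mathcal{I}_x=\{U\in X^*:x\notin U\}$. $X$ is a generalized Priestley space if: (1) $\langle X,\tau,\le\rangle$ is a Priestley space; (2) $X_0$ is dense; (3) every $x$ lies below some $y\in X_0$; (4) $x\in X_0$ iff for all $U,V\in\mathcal{I}_x$ there is $W\in\mathcal{I}_x$ with $U\cup V\subseteq W$; (5) $x\le y$ iff every $U\in X^*$ containing $x$ contains $y$. For such $X$, $\langle X^*,\cap,X,\emptyset\rangle$ is a bounded distributive meet semi-lattice. For a bounded distributive meet semi-lattice $L$ (a meet semi-lattice with top and bottom such that $b_1\wedge b_2\le a$ implies $a=c_1\wedge c_2$ for some $c_1\ge b_1$, $c_2\ge b_2$): a filter is a nonempty upset closed under $\wedge$; a prime filter is a filter $F\ne L$ such that $F_1\cap F_2\subseteq F$ for filters $F_1,F_2$ implies $F_1\subseteq F$ or $F_2\subseteq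 F$; $L_+$ is the set of prime filters; $\sigma(a)=\{y\in L_+:a\in y\}$; $D(L)$ is the lattice of finite unions of sets $\sigma(a)$; a filter $G$ is optimal if $G=\sigma^{-1}(P)$ for a prime filter $P$ of $D(L)$; $L_*$ is the set of optimal filters; $\phi(a)=\{y\in L_*:a\in y\}$; and $\tau$ on $L_*$ is generated by the subbasis $\{\phi(a)\}\cup\{L_*-\phi(b)\}$. Here $L=X^*$. *)

(* Defs.v *)
From HB Require Import structures.
From mathcomp Require Import all_boot all_order.
From mathcomp Require Import all_classical.
From mathcomp Require Import topology.

Set Implicit Arguments.
Unset Strict Implicit.
Unset Printing Implicit Defensive.

Import Order.TTheory SetOrder.Exports.
Local Open Scope classical_set_scope.
Local Open Scope order_scope.

Section Filters.
Context {d : Order.disp_t} {L : meetSemilatticeType d}.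

Definition up_closed {d' : Order.disp_t} {T : porderType d'} (A : set T) :=
  forall x y : T, x <= y -> A x -> A y.

Definition is_filter (F : set L) :=
  [/\ F !=set0, up_closed F & forall a b, F a -> F b -> F (a `&` b)].

Definition prime_filter (F : set L) :=
  [/\ is_filter F, F <> [set: L] &
      forall F1 F2 : set L, is_filter F1 -> is_filter F2 ->
        (F1 `&` F2 `<=` F)%classic -> (F1 `<=` F)%classic \/ (F2 `<=` F)%classic].

End Filters.

HB.mixin Record isDistrMeetSemilattice d L & Order.TBMeetSemilattice d L := {
  distr_meet : forall a b1 b2 : L, b1 `&` b2 <= a ->
    exists c1 c2 : L, [/\ b1 <= c1, b2 <= c2 & a = c1 `&` c2]
}.

#[short(type="tbDistrMeetSemilatticeType")]
HB.structure Definition TBDistrMeetSemilattice d :=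
  { L of isDistrMeetSemilattice d L & Order.TBMeetSemilattice d L }.

Section Spectra.
Context {d : Order.disp_t} (L : tbDistrMeetSemilatticeType d).

(** [L_+] *)
Definition prime_filters : Type := set_type (@prime_filter d L).

HB.instance Definition _ := SubChoice.on prime_filters.

Definition sigma (a : L) : set prime_filters := [set y | val y a].

Definition finite_union_sigma : set (set prime_filters) :=
  [set S | exists s : seq L, S = \bigcup_(a in [set` s]) sigma a].

Lemma sigmaI a b : sigma (a `&` b) = (sigma a `&` sigma b)%classic.
Proof.
apply/seteqP; split=> -[F pF] /=; rewrite /sigma /=.
  have /set_mem[[_ Fup _] _ _] := pF.
  by move=> Fab; split; apply: Fup Fab; rewrite ?leIl ?leIr.
by have /set_mem[[_ _ FI] _ _] := pF => -[Fa Fb]; exact: FI.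
Qed.

Lemma sigma1 : sigma \top = [set: prime_filters].
Proof.
apply/seteqP; split=> // -[F pF] _; rewrite /sigma /=.
have /set_mem[[[a Fa] Fup _] _ _] := pF.
by apply: Fup Fa; rewrite lex1.
Qed.

Lemma finite_union_sigma1 a : finite_union_sigma (sigma a).
Proof.
exists [:: a]; apply/seteqP; split=> [y ya|y [b /=]].
  by exists a => //=; rewrite inE.
by rewrite inE => /eqP ->.
Qed.

Lemma finite_union_sigmaU S S' : finite_union_sigma S ->
  finite_union_sigma S' -> finite_union_sigma (S `|` S')%classic.
Proof.
move=> [s ->] [s' ->]; exists (s ++ s'); apply/seteqP; split=> y.
  by move=> [[a /= sa ya]|[a /= sa ya]]; exists a => //=;
    rewrite mem_cat sa ?orbT.
by move=> [a /=]; rewrite mem_cat => /orP[] sa ya; [left|right]; exists a.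
Qed.

Lemma finite_union_sigmaI S S' : finite_union_sigma S ->
  finite_union_sigma S' -> finite_union_sigma (S `&` S')%classic.
Proof.
move=> [s ->] [s' ->]; exists [seq a `&` b | a <- s, b <- s'].
apply/seteqP; split=> y.
  move=> [[a /= sa ya] [b /= sb yb]]; exists (a `&` b); last by rewrite sigmaI.
  by apply/allpairsP; exists (a, b).
move=> [c /= /allpairsP[[a b] /= [sa sb ->]]]; rewrite sigmaI => -[ya yb].
by split; [exists a|exists b].
Qed.

Let D_setI : {in mem finite_union_sigma &, forall S S',
  (S `&` S')%O \in mem finite_union_sigma}.
Proof. by move=> S S'; rewrite !inE; exact: finite_union_sigmaI. Qed.

Let D_setU : {in mem finite_union_sigma &, forall S S',
  (S `|` S')%O \in mem finite_union_sigma}.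
Proof. by move=> S S'; rewrite !inE; exact: finite_union_sigmaU. Qed.

Let D_set0 : (\bot)%O \in mem finite_union_sigma.
Proof.
rewrite inE; exists [::]; apply/seteqP; split=> // y [a] /=.
by rewrite in_nil.
Qed.

Let D_setT : (\top)%O \in mem finite_union_sigma.
Proof. by rewrite inE topEset -sigma1; exact: finite_union_sigma1. Qed.

(** [D(L)], as a bounded sublattice of the powerset of [L_+] *)
Definition Dlattice : Type := set_type finite_union_sigma.

HB.instance Definition _ := SubChoice.on Dlattice.
HB.instance Definition _ := Order.SubChoice_isTBSubLattice.Build
  set_display (set prime_filters) (mem finite_union_sigma) set_display Dlattice
  D_setI D_setU D_set0 D_setT.

Definition sigmaD (a : L) : Dlattice := SigSub (mem_set (finite_union_sigma1 a)).

Definition optimal_filter (G : set L) :=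
  is_filter G /\
  exists2 P : set Dlattice, prime_filter P & G = sigmaD @^-1` P.

(** [L_*], ordered by inclusion *)
Definition optimal_filters : Type := set_type optimal_filter.

HB.instance Definition _ := SubChoice.on optimal_filters.
HB.instance Definition _ :=
  [SubChoice_isSubPOrder of optimal_filters by <: with set_display].

Definition phi (a : L) : set optimal_filters := [set y | val y a].

Definition optimal_subbasis : set (set optimal_filters) :=
  (range phi `|` range (fun b => ~` phi b))%classic.

HB.instance Definition _ := isSubBaseTopological.Build optimal_filters
  optimal_subbasis id.

End Spectra.

HB.mixin Record isPriestley d X & POrderedTopological d X := {
  priestley_compact : compact [set: X];
  priestley_sep : forall x y : X, ~ x <= y ->
    exists U : set X, [/\ clopen U, up_closed U, U x & ~ U y]
}.

#[short(type="priestleyType")]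
HB.structure Definition Priestley d :=
  { X of isPriestley d X & POrderedTopological d X }.

Section Star.
Context {d : Order.disp_t} {X : POrderedTopological.type d}.

Definition maximal_elements (A : set X) : set X :=
  [set x | A x /\ forall y, A y -> x <= y -> y = x].

(** [X^*] as a family of subsets of [X], for [X0] the distinguished subset *)
Definition star_sets (X0 : set X) : set (set X) :=
  [set U | [/\ clopen U, up_closed U & (maximal_elements (~` U) `<=` X0)%classic]].

Definition avoiding (X0 : set X) (x : X) : set (set X) :=
  [set U | star_sets X0 U /\ ~ U x].

End Star.

HB.mixin Record isGeneralizedPriestley d X & Priestley d X := {
  X0 : set X;
  X0_dense : dense X0;
  X0_above : forall x : X, exists2 y, X0 y & x <= y;
  X0P : forall x : X, X0 x <->
    (forall U V, avoiding X0 x U -> avoiding X0 x V ->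
       exists2 W, avoiding X0 x W & (U `|` V `<=` W)%classic);
  star_leP : forall x y : X, x <= y <->
    (forall U, star_sets X0 U -> U x -> U y)
}.

#[short(type="generalizedPriestleyType")]
HB.structure Definition GeneralizedPriestley d :=
  { X of isGeneralizedPriestley d X & Priestley d X }.

Section MaximalAbove.
Context {d : Order.disp_t} {X : priestleyType d}.

Lemma closed_ge (x : X) : closed [set y | x <= y].
Proof.
move=> y cly /=; apply: contrapT => /priestley_sep[U [[oU cU] upU Ux nUy]].
apply: nUy; apply: cU => B By; have [z [xz Bz]] := cly B By.
by exists z; split=> //; exact: upU xz Ux.
Qed.

Lemma maximal_above (A : set X) (x : X) : closed A -> A x ->
  exists2 m, maximal_elements A m & x <= m.
Proof.
move=> cA Ax.
pose T := {y : X | (y \in A) && (x <= y)}.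
have xT : (x \in A) && (x <= x) by rewrite lexx andbT; apply/mem_set.
pose R (s t : T) := val s <= val t.
have [|||C totC|[m mT] mmax] := @Zorn T R.
- by move=> t; exact: lexx.
- by move=> r s t; exact: le_trans.
- by move=> s t st ts; apply/val_inj/le_anti/andP.
- have [[c0 Cc0]|C0] := pselect (exists c, C c); last first.
    by exists (exist _ x xT) => s Cs; case: C0; exists s.
  pose B (c : T) := [set y | A y /\ val c <= y].
  have FF : ProperFilter (filter_from C B).
    apply: filter_from_proper; last first.
      move=> c Cc; exists (val c); split; last exact: lexx.
      by have /andP[/set_mem] := valP c.
    apply: filter_from_filter; first by exists c0.
    move=> i j Ci Cj; have [ij|ji] := totC _ _ Ci Cj.
      exists j => // y [Ay jy]; split; split=> //.
      exact: (le_trans ij jy).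
    exists i => // y [Ay iy]; split; split=> //.
    exact: (le_trans ji iy).
  have [p [_ clp]] := priestley_compact _ FF filterT.
  have Bp c : C c -> B c p.
    move=> Cc; split.
      apply: cA => N Np; have [|y [[Ay _] Ny]] := clp (B c) N _ Np.
        by exists c.
      by exists y.
    apply: closed_ge => N Np; have [|y [[_ cy] Ny]] := clp (B c) N _ Np.
      by exists c.
    by exists y.
  have pT : (p \in A) && (x <= p).
    have [Ap cp] := Bp _ Cc0; apply/andP; split; first exact/mem_set.
    by have /andP[_ xc] := valP c0; exact: le_trans cp.
  by exists (exist _ p pT) => s /Bp[].
have /andP[/set_mem Am xm] := mT; exists m => //; split=> // y Ay my.
have yT : (y \in A) && (x <= y).
  by rewrite (le_trans xm my) andbT; exact/mem_set.
by have /(congr1 val) := mmax (exist _ y yT) my.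
Qed.

End MaximalAbove.

Section StarSemilattice.
Context {d : Order.disp_t} (X : generalizedPriestleyType d).
Implicit Types U V W : set X.

Lemma star_setsI U V : star_sets X0 U -> star_sets X0 V ->
  star_sets X0 (U `&` V)%classic.
Proof.
move=> [cU upU mU] [cV upV mV]; split; first exact: clopenI.
  by move=> x y xy [Ux Vx]; split; [exact: upU xy Ux|exact: upV xy Vx].
move=> x [/not_andP[nUx|nVx] xmax]; [apply: mU|apply: mV]; split=> // y ny xy;
  by apply: xmax => // -[].
Qed.

Lemma star_setsT : star_sets X0 [set: X].
Proof. by split=> //; [exact: clopenT|move=> x []; rewrite setCT]. Qed.

Lemma star_sets0 : star_sets X0 (set0 : set X).
Proof.
split=> //; first exact: clopen0.
move=> x [_ xmax]; have [y X0y xy] := X0_above x.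
by rewrite -(xmax y _ xy).
Qed.

(** [X^*], ordered by inclusion; its bottom [set0] is an element because every
    point of [X] lies below a point of [X0] *)
Definition star : Type := set_type (star_sets (@X0 d X)).

HB.instance Definition _ := SubChoice.on star.
HB.instance Definition _ :=
  [SubChoice_isSubPOrder of star by <: with set_display].

Lemma starP (U : star) : star_sets X0 (val U).
Proof. exact: set_mem (valP U). Qed.

Lemma star_le (U V : star) : U <= V <-> (val U `<=` val V)%classic.
Proof. by split=> [/subsetPset|UV]; [|exact/subsetPset]. Qed.

Definition star_meet (U V : star) : star :=
  SigSub (mem_set (star_setsI (starP U) (starP V))).

Let star_meetC : commutative star_meet.
Proof. by move=> U V; apply: val_inj; exact: setIC. Qed.

Let star_meetA : associative star_meet.
Proof. by move=> U V W; apply: val_inj; exact: setIA. Qed.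

Let star_leEmeet (U V : star) : (U <= V) = (star_meet U V == U).
Proof.
apply/idP/eqP => [/star_le UV|<-]; first by apply: val_inj; exact/setIidPl.
by apply/star_le => x [].
Qed.

HB.instance Definition _ := Order.POrder_Meet_isSemilattice.Build set_display
  star star_meetC star_meetA star_leEmeet.

Let star_le1 (U : star) : U <= (SigSub (mem_set star_setsT) : star).
Proof. exact/star_le. Qed.

Let star_le0 (U : star) : (SigSub (mem_set star_sets0) : star) <= U.
Proof. exact/star_le. Qed.

HB.instance Definition _ := Order.hasTop.Build set_display star star_le1.
HB.instance Definition _ := Order.hasBottom.Build set_display star star_le0.

Let star_distr (W U V : star) : U `&` V <= W ->
  exists U' V' : star, [/\ U <= U', V <= V' & W = U' `&` V'].
Proof.
move=> /star_le UVW.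
pose above (A : star) := [set A' : star | A <= A' /\ W <= A'].
pose D := [set p : star * star | above U p.1 /\ above V p.2].
pose B (p : star * star) := ((val p.1 `&` val p.2) `\` val W)%classic.
have [[[U' V'] [[/= UU WU] [VV WV]] B0]|BN0] :=
    pselect (exists2 p, D p & ~ (B p !=set0)).
  exists U', V'; split=> //; apply/le_anti/andP; split.
    by rewrite lexI WU WV.
  apply/star_le => x UVx; apply: contrapT => nWx.
  by apply: B0; exists x.
have FF : ProperFilter (filter_from D B).
  apply: filter_from_proper; last first.
    by move=> p Dp; apply: contrapT => Bp; apply: BN0; exists p.
  apply: filter_from_filter.
    by exists (\top, \top); split; split=> /=; rewrite lex1.
  move=> [U1 V1] [U2 V2] [[/= ? ?] [? ?]] [[/= ? ?] [? ?]].
  exists (U1 `&` U2, V1 `&` V2).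
    by split; split=> /=; rewrite lexI; apply/andP.
  by move=> x [[[/= ? ?] [? ?]] ?]; split; split.
have [p [_ clp]] := priestley_compact _ FF filterT.
have Bp q : D q -> B q p.
  move=> Dq; have clpq N : nbhs p N -> (B q `&` N)%classic !=set0.
    by apply: clp; exists q.
  have [[_ cU] _ _] := starP q.1; have [[_ cV] _ _] := starP q.2.
  have [[oW _] _ _] := starP W.
  split; first split.
  - by apply: cU => N /clpq[y [[[? _] _] ?]]; exists y.
  - by apply: cV => N /clpq[y [[[_ ?] _] ?]]; exists y.
  - have : closed (~` val W)%classic by rewrite closedC.
    by apply=> N /clpq[y [[_ ?] ?]]; exists y.
have nWp : ~ val W p.
  by have [|//] := Bp (\top, \top); split; split=> /=; rewrite lex1.
have [[oW _] upW mW] := starP W.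
have cW : closed (~` val W)%classic by rewrite closedC.
have [m mmax pm] := maximal_above cW nWp.
have [nWm _] := mmax.
have X0m := (X0P m).1 (mW _ mmax).
have key (A : star) : ~ val A m -> exists2 A', above A A' & ~ val A' p.
  move=> nAm; have [||S [sS nSm] ASW] := X0m (val A) (val W).
  - by split=> //; exact: starP.
  - by split=> //; exact: starP.
  exists (SigSub (mem_set sS)).
    by split; apply/star_le => x ?; apply: ASW; [left|right].
  by move=> /= Sp; apply: nSm; have [_ upS _] := sS; exact: upS pm Sp.
have /not_andP[/key[A' aA nA]|/key[A' aA nA]] : ~ (val U m /\ val V m).
    by move=> UVm; apply: nWm; exact: UVW.
- have Dp : D (A', \top) by split=> //=; split; rewrite lex1.
  by have [[]] := Bp _ Dp.
- have Dp : D (\top, A') by split=> //=; split; rewrite lex1.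
  by have [[]] := Bp _ Dp.
Qed.

HB.instance Definition _ :=
  isDistrMeetSemilattice.Build set_display star star_distr.

Definition psi (x : X) : set star := [set U | val U x].

End StarSemilattice.

Definition order_isomorphism {d d' : Order.disp_t} {P : porderType d}
    {Q : porderType d'} (f : P -> Q) :=
  bijective f /\ forall x y, x <= y <-> f x <= f y.

Definition homeomorphism {S T : topologicalType} (f : S -> T) :=
  exists g : T -> S,
    [/\ cancel f g, cancel g f, continuous f & continuous g].

(* Main.v *)
(** Write [L = X^*]. A point [x] of [X0] gives a prime filter because, by
    condition (4), the members of [L] avoiding [x] are directed. If [U] in [G]
    is never covered by finitely many members of [L] outside [G], compactness
    of [X] yields [x] with [G = psi x]: this applies to prime filters, whose
    complements are directed, and to optimal filters, through the prime filter
    of [D(L)] that defines them. Conversely, density of [X0] shows that an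
    inclusion [sigma a <= sigma b1 \/ ... \/ sigma bn] reflects an inclusion of
    clopen subsets of [X], so the members of [D(L)] lying above some [sigma a]
    with [x] in [a] form a prime filter, and [psi x] is optimal. The topology of
    [L_*] is Hausdorff, hence the continuous bijection [psi] from the compact
    space [X] is a homeomorphism. *)
Require Import Defs.
From HB Require Import structures.
From mathcomp Require Import all_boot all_order.
From mathcomp Require Import all_classical.
From mathcomp Require Import topology.

Import Order.TTheory.

Local Open Scope classical_set_scope.

(** * Upper bounds outside a prime filter *)

Section PrimeFilters.
Context {d : Order.disp_t} {L : meetSemilatticeType d}.
Implicit Types (a b c : L) (F : set L).
Local Open Scope order_scope.

Lemma principal_filter a : is_filter [set b | a <= b].
Proof.
split; first by exists a => /=; exact: lexx.
  by move=> b c bc /= ab; exact: le_trans bc.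
by move=> b c /= ab ac; rewrite lexI ab.
Qed.

(** The principal filters of [a] and [b] meet in the common upper bounds of [a] and [b]; were these
    all in [F], primeness would put [a] or [b] in [F]. *)
Lemma prime_filter_directed F a b : prime_filter F -> ~ F a -> ~ F b ->
  exists c, [/\ a <= c, b <= c & ~ F c].
Proof.
move=> [_ _ primeF] nFa nFb; apply: contrapT => nc.
have [|/(_ a)|/(_ b)] := primeF _ _ (principal_filter a) (principal_filter b).
- by move=> c [/= ac bc]; apply: contrapT => nFc; apply: nc; exists c.
- by move/(_ (lexx a)).
- by move/(_ (lexx b)).
Qed.

Lemma prime_filter_ub F (s : seq L) : prime_filter F ->
  (forall a, a \in s -> ~ F a) ->
  exists2 c, ~ F c & forall a, a \in s -> a <= c.
Proof.
move=> primeF; elim: s => [_|a s IHs nFs].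
  (* Properness of [F] supplies the bound for the empty list. *)
  have [_ FT _] := primeF; apply: contrapT => nc; apply: FT.
  apply/seteqP; split=> // c _; apply: contrapT => nFc.
  by apply: nc; exists c.
have [|b nFb sb] := IHs.
  by move=> b bs; apply: nFs; rewrite inE bs orbT.
have [|c [ac bc nFc]] := prime_filter_directed _ a b primeF _ nFb.
  by apply: nFs; rewrite inE eqxx.
exists c => // e; rewrite inE => /orP[/eqP -> //|/sb eb].
exact: le_trans bc.
Qed.

End PrimeFilters.

(** * The topology of [L_*] *)

Section OptimalSpectrum.
Context {d : Order.disp_t} {L : tbDistrMeetSemilatticeType d}.

Lemma Dlattice_le (S T : Dlattice L) :
  (S <= T)%O <-> val S `<=` val T.
Proof. by split=> [/subsetPset|ST]; [|exact/subsetPset]. Qed.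

Lemma open_phi (a : L) : open (phi a).
Proof.
exists [set phi a]; last by rewrite bigcup_set1.
by move=> _ ->; apply: (@finI_from1 _ _ _ id); left; exists a.
Qed.

Lemma open_phiC (a : L) : open (~` phi a).
Proof.
exists [set ~` phi a]; last by rewrite bigcup_set1.
by move=> _ ->; apply: (@finI_from1 _ _ _ id); right; exists a.
Qed.

Lemma optimal_filters_hausdorff : hausdorff_space (optimal_filters L).
Proof.
rewrite open_hausdorff => y z yz.
have [a yza] : exists a, ~ (val y a <-> val z a).
  apply: contrapT => nyz; move/eqP: yz; apply; apply: val_inj.
  apply/predeqP => a; apply: contrapT => yza; apply: nyz; by exists a.
have [ya|nya] := pselect (val y a).
  exists (phi a, ~` phi a).
    by split; apply/mem_set => //= za; apply: yza.
  by split; [exact: open_phi|exact: open_phiC|rewrite /= setICr].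
exists (~` phi a, phi a).
  split; apply/mem_set => //=; apply: contrapT => nza; exact: yza.
by split; [exact: open_phiC|exact: open_phi|rewrite /= setICl].
Qed.

Lemma continuous_optimal_filters (T : topologicalType)
    (f : T -> optimal_filters L) :
  (forall a, clopen (f @^-1` phi a)) -> continuous f.
Proof.
move=> fphi; apply/continuousP => _ [B subB <-].
rewrite preimage_bigcup; apply: bigcup_open => _ /subB[/= s ssub <-].
rewrite preimage_bigcap bigcap_fset big_seq_cond; apply: big_ind.
- exact: openT.
- exact: openI.
- move=> A /andP[/ssub/set_mem[|] [a _ <-] _]; have [oa ca] := fphi a => //.
  by rewrite -preimage_setC openC.
Qed.

End OptimalSpectrum.

(** A closed set of [S] is compact, so its image, which is its preimage under the inverse, is closed
    in [T]. *)
Lemma compact_hausdorff_homeomorphism (S T : topologicalType) (f : S -> T) :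
  compact [set: S] -> hausdorff_space T -> bijective f -> continuous f ->
  homeomorphism f.
Proof.
move=> cS hT [g fK gK] fcont; exists g; split=> //.
apply/continuous_closedP => A clA.
have -> : g @^-1` A = f @` A.
  apply/seteqP; split=> [y /= Agy|_ [x Ax <-] /=]; last by rewrite fK.
  by exists (g y).
apply: compact_closed => //; apply: continuous_compact.
  exact: continuous_subspaceT.
exact: subclosed_compact cS _.
Qed.

(** * The filters [psi x] and the prime filters of [X^*] *)

Section Psi.
Context {d : Order.disp_t} (X : generalizedPriestleyType d).
Implicit Types (x y : X) (U V W : star X) (s : seq (star X)).

Lemma psi_filter x : is_filter (psi x).
Proof.
split; first by exists \top%O.
  by move=> U V /star_le UV; exact: UV.
by move=> U V Ux Vx; split.
Qed.

Lemma psi_prime x : X0 x -> prime_filter (psi x).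
Proof.
move=> /X0P dirx; split; first exact: psi_filter.
  by move/seteqP => [_ /(_ \bot%O I)].
move=> F1 F2 [_ up1 _] [_ up2 _] F12; apply: contrapT => /not_orP[].
move=> /existsNP[U /not_implyP[F1U nUx]] /existsNP[V /not_implyP[F2V nVx]].
(* Since [x] is in [X0], some [W] in [X^*] avoids [x] and contains [U] and [V]; it lies in both [F1]
   and [F2]. *)
have [||W [sW nWx] UVW] := dirx (val U) (val V).
- by split=> //; exact: starP.
- by split=> //; exact: starP.
pose W' : star X := SigSub (mem_set sW).
apply: nWx; apply: (F12 W'); split.
  by apply: up1 F1U; apply/star_le => z Uz; apply: UVW; left.
by apply: up2 F2V; apply/star_le => z Vz; apply: UVW; right.
Qed.

Lemma filter_psi (G : set (star X)) : is_filter G ->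
  (forall U s, G U -> (forall V, V \in s -> ~ G V) ->
     ~ (val U `<=` \bigcup_(V in [set` s]) val V)) ->
  exists x, G = psi x.
Proof.
move=> [[U0 GU0] _ GI] Gcover.
(* The sets [B p] with [p] in [D] form a filter base; any cluster point [x] of it satisfies
   [G = psi x]. *)
pose D := [set p : star X * seq (star X) | G p.1 /\
  forall V, V \in p.2 -> ~ G V].
pose B (p : star X * seq (star X)) :=
  val p.1 `\` \bigcup_(V in [set` p.2]) val V.
have FF : ProperFilter (filter_from D B).
  apply: filter_from_proper; last first.
    move=> [U s] [/= GU Gs]; apply: contrapT => Bp; apply: (Gcover _ _ GU Gs).
    by move=> x Ux; apply: contrapT => sx; apply: Bp; exists x.
  apply: filter_from_filter; first by exists (U0, [::]).
  move=> [U s] [V t] [/= GU Gs] [/= GV Gt].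
  exists (Order.meet U V, s ++ t).
    split=> /=; first exact: GI.
    by move=> W; rewrite mem_cat => /orP[/Gs|/Gt].
  move=> x [[/= Ux Vx] nst]; split; split=> // -[W Ws Wx]; apply: nst;
    by exists W => //=; rewrite mem_cat Ws ?orbT.
have [x [_ clx]] := priestley_compact _ FF filterT.
exists x; apply/seteqP; split=> U.
  move=> GU; have [[_ cU] _ _] := starP U; apply: cU => N Nx.
  have [|y [[Uy _] Ny]] := clx (B (U, [::])) N _ Nx; last by exists y.
  by exists (U, [::]).
(* [U] is a neighbourhood of [x] that misses [B (U0, [:: U])]. *)
move=> Ux; apply: contrapT => nGU; have [[oU _] _ _] := starP U.
have [||y [[_ nUy] Uy]] := clx (B (U0, [:: U])) (val U).
- exists (U0, [:: U]) => //; split=> //= V.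
  by rewrite inE => /eqP ->.
- exact: open_nbhs_nbhs.
- by apply: nUy; exists U => //=; rewrite inE.
Qed.

Lemma prime_filter_psi (F : set (star X)) : prime_filter F ->
  exists2 x, X0 x & F = psi x.
Proof.
move=> primeF; have [Ff _ _] := primeF; have [_ upF _] := Ff.
have [|x Fx] := filter_psi F Ff.
  (* A bound of [s] outside [F] would contain [U], so [s] cannot cover [U]. *)
  move=> U s FU Fs Us; have [W nFW sW] := prime_filter_ub _ _ primeF Fs.
  apply: nFW; apply: upF FU; apply/star_le => x /Us[V /sW /star_le VW].
  exact: VW.
exists x => //; apply/X0P => U V [sU nUx] [sV nVx].
pose U' : star X := SigSub (mem_set sU); pose V' : star X := SigSub (mem_set sV).
have [||W [/star_le UW /star_le VW nFW]] := prime_filter_directed F U' V' primeF.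
- by rewrite Fx.
- by rewrite Fx.
exists (val W); first by split; [exact: starP|move: nFW; rewrite Fx].
by move=> z [/UW|/VW].
Qed.

(** * Optimal filters of [X^*] *)

Lemma sigma_subset_cover U s :
  sigma U `<=` \bigcup_(V in [set` s]) sigma V <->
  val U `<=` \bigcup_(V in [set` s]) val V.
Proof.
split=> [Us|Us y].
  apply: contrapT => /existsNP[z /not_implyP[Uz sz]].
  have [[oU _] _ _] := starP U.
  have cs : closed (\bigcup_(V in [set` s]) val V).
    by rewrite bigcup_seq; apply: closed_bigsetU => V _; have [[]] := starP V.
  (* The uncovered part of [U] is open, so density puts a point [x] of [X0] in it; the prime filter
     [psi x] contains [U] but no member of [s]. *)
  have [||x [[Ux sx] X0x]] := X0_dense (val U `\` \bigcup_(V in [set` s]) val V).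
  - by exists z.
  - by apply: openI => //; rewrite openC.
  have [V Vs Vx] := Us (SigSub (mem_set (psi_prime _ X0x))) Ux.
  by apply: sx; exists V.
have [x _ yx] := prime_filter_psi _ (set_mem (valP y)).
rewrite /sigma /= yx => /Us[V Vs Vx]; exists V => //=.
by rewrite /sigma /= yx.
Qed.

Lemma sigma_subset U V : sigma U `<=` sigma V <-> val U `<=` val V.
Proof.
have := sigma_subset_cover U [:: V].
by rewrite !bigcup_seq !big_seq1.
Qed.

Lemma psi_optimal x : optimal_filter (psi x).
Proof.
split; first exact: psi_filter.
pose P := [set S : Dlattice (star X) | 
    exists2 U : star X, val U x & sigma U `<=` val S].
have PE U : P (sigmaD U) <-> val U x.
  split=> [[V Vx /sigma_subset VU]|Ux]; first exact: VU.
  by exists U.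
exists P; last by apply/seteqP; split=> U /PE.
split.
- split.
  + by exists (sigmaD (\top : star X)%O); apply/PE.
  + move=> S T /Dlattice_le ST [U Ux US]; exists U => //.
    exact: subset_trans ST.
  + move=> S T [U Ux US] [V Vx VT]; exists (Order.meet U V); first by split.
    by rewrite sigmaI => y [/US Sy /VT Ty]; split.
- by move=> PT; have /PE : P (sigmaD (\bot : star X)%O) by rewrite PT.
move=> F1 F2 [_ up1 _] [_ up2 _] F12; apply: contrapT => /not_orP[].
move=> /existsNP[S /not_implyP[F1S nPS]] /existsNP[T /not_implyP[F2T nPT]].
(* The join lies in both filters, hence in [P]; the resulting cover of some [U] containing [x] puts
   [x] in a [V] listed for [S] or for [T]. *)
have [|U Ux UST] := F12 (Order.join S T).
  split; first by apply: up1 F1S; rewrite leUl.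
  by apply: up2 F2T; rewrite leUr.
have [s Es] := set_mem (valP S); have [t Et] := set_mem (valP T).
have /sigma_subset_cover Ust :
    sigma U `<=` \bigcup_(V in [set` s ++ t]) sigma V.
  move=> y /UST; rewrite /= [X in X y]/(val S `|` val T) Es Et.
  by move=> -[[V Vs Vy]|[V Vt Vy]]; exists V => //=; rewrite mem_cat ?Vs ?Vt ?orbT.
have [V /= ] := Ust x Ux; rewrite mem_cat => /orP[Vs|Vt] Vx.
  by apply: nPS; exists V => //; rewrite Es => y Vy; exists V.
by apply: nPT; exists V => //; rewrite Et => y Vy; exists V.
Qed.

Lemma optimal_filter_psi (G : set (star X)) : optimal_filter G ->
  exists x, G = psi x.
Proof.
move=> [Gf [P primeP GE]]; apply: filter_psi => // U s GU Gs Us.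
(* [C] lies above every [sigmaD V] with [V] in [s], so a cover of [U] by [s] would put [sigmaD U]
   below [C], forcing [C] into [P]. *)
have [|C nPC sC] := prime_filter_ub P [seq sigmaD V | V <- s] primeP.
  by move=> _ /mapP[V Vs ->]; have := Gs V Vs; rewrite GE.
have [[_ upP _] _ _] := primeP; apply: nPC.
have PU : P (sigmaD U) by move: GU; rewrite GE.
apply: upP PU; apply/Dlattice_le => y Uy.
have [V /= Vs Vy] := (sigma_subset_cover U s).2 Us y Uy.
have /Dlattice_le : (sigmaD V <= C)%O by apply: sC; exact: map_f.
exact.
Qed.

(** * [psi] as a map into the ordered space [L_*] *)

Definition psi_spec x : optimal_filters (star X) :=
  SigSub (mem_set (psi_optimal x)).

Lemma psi_spec_le x y : (x <= y)%O <-> (psi_spec x <= psi_spec y)%O.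
Proof.
split=> [xy|/subsetPset xy].
  apply/subsetPset => U Ux; have [_ upU _] := starP U; exact: upU xy Ux.
by apply/star_leP => U sU Ux; exact: (xy (SigSub (mem_set sU))).
Qed.

Lemma psi_spec_bij : bijective psi_spec.
Proof.
have surj (F : optimal_filters (star X)) : exists x, psi_spec x = F.
  have [x Fx] := optimal_filter_psi _ (set_mem (valP F)).
  by exists x; apply: val_inj.
have [g gK] := choice surj; exists g => // x.
(* Injectivity follows from antisymmetry, since the order is reflected. *)
apply: le_anti; apply/andP.
by split; apply/psi_spec_le; rewrite gK lexx.
Qed.

Lemma psi_spec_continuous : continuous psi_spec.
Proof.
(* The preimage of [phi U] is [val U], which is clopen. *)
by apply: continuous_optimal_filters => U; have [] := starP U.
Qed.

End Psi.

Theorem theorem6p21 (d : Order.disp_t) (X : generalizedPriestleyType d) :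
  exists f : X -> optimal_filters (star X),
    [/\ forall x, val (f x) = psi x,
        order_isomorphism f,
        homeomorphism f &
        @psi d X @` X0 = [set F | prime_filter F]].
Proof.
exists (@psi_spec d X); split=> //.
- by split; [exact: psi_spec_bij|exact: psi_spec_le].
- apply: compact_hausdorff_homeomorphism.
  + exact: priestley_compact.
  + exact: optimal_filters_hausdorff.
  + exact: psi_spec_bij.
  + exact: psi_spec_continuous.
- apply/seteqP; split=> [_ [x X0x <-]|F /prime_filter_psi[x X0x ->]].
    exact: psi_prime.
  by exists x.
Qed.
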